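(* Let $\mathbb G$ be a Carnot group and $f\in C^3(\mathbb G)$. Then $$\Delta_H(|\tilde\nabla_Hf|^2)=2\langle\tilde\nabla_Hf,\tilde\nabla_H(\Delta_Hf)\rangle+2\sum_{i=1}^m|\tilde\nabla_H(X_if)|^2.$$ If in particular $\Delta_Hf=c$ for some $c\in\mathbb R$, then $$\Delta_H(|\tilde\nabla_Hf|^2)=2\sum_{i=1}^m|\tilde\nabla_H(X_if)|^2\ge0.$$
   Context: A Carnot group of step $k\ge1$ is a simply-connected real Lie group $(\mathbb G,\circ)$ whose Lie algebra is stratified, $\mathfrak g=\mathfrak g_1\oplus\dots\oplus\mathfrak g_k$, with $[\mathfrak g_1,\mathfrak g_j]=\mathfrak g_{j+1}$ for $1\le j\le k-1$ and $[\mathfrak g_1,\mathfrak g_k]=\{0\}$; $\mathfrak g$ carries a scalar product making the layers mutually orthogonal. Let $m=\dim\mathfrak g_1$ and fix an orthonormal basis $e_1,\dots,e_m$ of $\mathfrak g_1$. Define the left- and right-invariant vector fields $$X_if(g)=\tfrac{d}{dt}f(g\circ\exp(te_i))\big|_{t=0},\qquad \tilde X_if(g)=\tfrac{d}{dt}f(\exp(te_i)\circ g)\big|_{t=0}.$$ Set $\Delta_Hf=\sum_{i=1}^mX_i^2f$, $\langle\tilde\nabla_Hu,\tilde\nabla_Hv\rangle=\sum_{j=1}^m\tilde X_ju\,\tilde X_jv$, and $|\tilde\nabla_Hu|^2=\sum_{j=1}^m(\tilde X_ju)^2$. *)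

(* Defs.v *)
From HB Require Import structures.
From mathcomp Require Import all_boot all_order all_algebra.
From mathcomp Require Import sesquilinear.
From mathcomp Require Import all_classical all_reals all_analysis.

Set Implicit Arguments.
Unset Strict Implicit.
Unset Printing Implicit Defensive.

Import Order.TTheory GRing.Theory Num.Theory.
Import numFieldNormedType.Exports.

Local Open Scope classical_set_scope.
Local Open Scope ring_scope.

(* [U] is meant to be open and [V] finite dimensional: there, a map is C^(k+1)
   iff it is differentiable with all its directional derivatives C^k. *)
Fixpoint Ck_on (R : realType) (V W : normedModType R) (k : nat) (U : set V)
    (f : V -> W) : Prop :=
  match k with
  | 0 => forall x, U x -> {for x, continuous f}
  | k'.+1 => (forall x, U x -> differentiable f x) /\
             (forall v : V, Ck_on k' U ('D_v f))
  end.

(* Only the values of [cmap] on [cdom], and of [cinv] on the image of [cdom],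
   are meaningful. *)
Record chart (M V : Type) := Chart {
  cdom : set M;
  cmap : M -> V;
  cinv : V -> M }.

Definition id_chart (V : Type) : chart V V := Chart setT id id.

Definition prod_chart (M N V W : Type) (a : chart M V) (b : chart N W) :
    chart (M * N) (V * W) :=
  Chart (cdom a `*` cdom b)
        (fun p => (cmap a p.1, cmap b p.2))
        (fun p => (cinv a p.1, cinv b p.2)).

Definition prod_atlas (M N V W : Type) (A : set (chart M V))
    (B : set (chart N W)) : set (chart (M * N) (V * W)) :=
  [set c | exists a b, [/\ A a, B b & c = prod_chart a b]].

Definition is_chart (R : realType) (M : topologicalType) (V : normedModType R)
    (c : chart M V) : Prop :=
  [/\ open (cdom c), open (cmap c @` cdom c),
      {within cdom c, continuous (cmap c)},
      {within cmap c @` cdom c, continuous (cinv c)} &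
      forall x, cdom c x -> cinv c (cmap c x) = x].

Definition is_smooth_atlas (R : realType) (M : topologicalType)
    (V : normedModType R) (A : set (chart M V)) : Prop :=
  [/\ forall c, A c -> is_chart c,
      forall x, exists2 c, A c & cdom c x &
      forall a b k, A a -> A b ->
        Ck_on k (cmap a @` (cdom a `&` cdom b)) (cmap b \o cinv a)].

Definition Ck_map (R : realType) (M N : topologicalType)
    (V W : normedModType R) (k : nat) (A : set (chart M V))
    (B : set (chart N W)) (F : M -> N) : Prop :=
  continuous F /\
  forall a b, A a -> B b ->
    Ck_on k (cmap a @` (cdom a `&` F @^-1` cdom b))
            (cmap b \o F \o cinv a).

Definition smooth_map (R : realType) (M N : topologicalType)
    (V W : normedModType R) (A : set (chart M V)) (B : set (chart N W))
    (F : M -> N) : Prop :=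
  forall k, Ck_map k A B F.

HB.mixin Record isLieGroup (R : realType) (n : nat) G
    of Group G & Topological G := {
  lie_atlas : set (chart G 'rV[R]_n);
  lie_atlas_smooth : is_smooth_atlas lie_atlas;
  lie_hausdorff : hausdorff_space G;
  lie_second_countable : @second_countable G;
  lie_mul_smooth : smooth_map (prod_atlas lie_atlas lie_atlas) lie_atlas
    (fun p : G * G => (p.1 * p.2)%g);
  lie_inv_smooth : smooth_map lie_atlas lie_atlas (fun x : G => (x^-1)%g) }.

#[short(type="lieGroupType")]
HB.structure Definition LieGroup (R : realType) (n : nat) :=
  {G of isLieGroup R n G & Group G & Topological G}.

Definition simply_connected (R : realType) (T : topologicalType) : Prop :=
  (forall x y : T, exists p : R -> T,
     [/\ {within `[0, 1], continuous p}, p 0 = x & p 1 = y]) /\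
  (forall p : R -> T, {within `[0, 1], continuous p} -> p 0 = p 1 ->
     exists H : R * R -> T,
       [/\ {within `[0, 1] `*` `[0, 1], continuous H},
           forall t, t \in `[0, 1] -> H (0, t) = p t,
           forall t, t \in `[0, 1] -> H (1, t) = p 0 &
           forall s, s \in `[0, 1] -> H (s, 0) = p 0 /\ H (s, 1) = p 0]).

Section LieAlgebra.
Context (R : realType) (n : nat) (G : lieGroupType R n).

Definition Ck_fun (k : nat) (f : G -> R^o) : Prop :=
  Ck_map k (@lie_atlas R n G) [set id_chart R^o] f.

Definition smooth_fun (f : G -> R^o) : Prop := forall k, Ck_fun k f.

(* A smooth vector field is a derivation of the algebra of smooth functions;
   the values of [D] outside that algebra are irrelevant. *)
Definition left_invariant_field (D : (G -> R^o) -> (G -> R^o)) : Prop :=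
  [/\ forall f, smooth_fun f -> smooth_fun (D f),
      forall (a : R) f h, smooth_fun f -> smooth_fun h ->
        D (fun x => a * f x + h x) = (fun x => a * D f x + D h x),
      forall f h, smooth_fun f -> smooth_fun h ->
        D (fun x => f x * h x) = (fun x => D f x * h x + f x * D h x) &
      forall (g : G) f, smooth_fun f ->
        D (fun x => f (g * x)%g) = (fun x => D f (g * x)%g)].

(* The Lie algebra of [G], presented as a finite-dimensional vector space
   identified by [lie_field] with the left-invariant vector fields, the bracket
   being the commutator of vector fields. *)
Record lieAlgebra := LieAlgebra {
  lie_space :> vectType R;
  lie_bracket : lie_space -> lie_space -> lie_space;
  lie_field : lie_space -> (G -> R^o) -> (G -> R^o);
  lie_field_left_invariant : forall x, left_invariant_field (lie_field x);
  lie_field_linear : forall (a : R) x y f, smooth_fun f ->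
    lie_field (a *: x + y) f = (fun g => a * lie_field x f g + lie_field y f g);
  lie_field_inj : forall x y,
    (forall f, smooth_fun f -> lie_field x f = lie_field y f) -> x = y;
  lie_field_surj : forall D, left_invariant_field D ->
    exists x, forall f, smooth_fun f -> lie_field x f = D f;
  lie_field_bracket : forall x y f, smooth_fun f ->
    lie_field (lie_bracket x y) f =
    (fun g => lie_field x (lie_field y f) g - lie_field y (lie_field x f) g) }.

(* [t |-> E (t *: v)] is the one-parameter subgroup with velocity [v] at the
   identity; this determines [E]. *)
Definition is_exponential (L : lieAlgebra) (E : L -> G) : Prop :=
  forall v : L,
  [/\ smooth_map [set id_chart R^o] (@lie_atlas R n G)
        (fun t : R^o => E (t *: v)),
      forall s t : R, E ((s + t) *: v) = (E (s *: v) * E (t *: v))%g &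
      forall f, smooth_fun f ->
        is_derive (0 : R^o) 1 (fun t : R^o => f (E (t *: v)))
          (lie_field v f 1%g)].

(* [W = [U, V]], the span of the brackets of elements of [U] and [V]. *)
Definition is_bracket_space (L : lieAlgebra) (U V W : {vspace L}) : Prop :=
  (forall x y, x \in U -> y \in V -> lie_bracket x y \in W) /\
  (forall W' : {vspace L},
     (forall x y, x \in U -> y \in V -> lie_bracket x y \in W') ->
     (W <= W')%VS).

(* The layers are indexed from 1 to [step]; [layer] is irrelevant elsewhere. *)
Record carnot := Carnot {
  carnot_simply_connected : simply_connected R G;
  carnot_lie : lieAlgebra;
  step : nat;
  layer : nat -> {vspace carnot_lie};
  carnot_dot : {dot carnot_lie for idfun};
  step_gt0 : (0 < step)%N;
  layer_sum : (\sum_(i < step) layer i.+1)%VS = fullv;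
  layer_direct : directv (\sum_(i < step) layer i.+1)%VS;
  layer_bracket : forall j, (1 <= j < step)%N ->
    is_bracket_space (layer 1) (layer j) (layer j.+1);
  layer_bracket_last : is_bracket_space (layer 1) (layer step) 0%VS;
  layer_orthogonal : forall i j, (1 <= i <= step)%N -> (1 <= j <= step)%N ->
    i != j -> forall x y, x \in layer i -> y \in layer j ->
    carnot_dot x y = 0 }.

Definition hdim (C : carnot) : nat := \dim (layer C 1).

Definition orthonormal_hbasis (C : carnot)
    (e : (hdim C).-tuple (carnot_lie C)) : Prop :=
  basis_of (layer C 1) e /\
  forall i j, carnot_dot C (tnth e i) (tnth e j) = (i == j)%:R.

Section HorizontalOperators.
Context (L : lieAlgebra) (E : L -> G) (m : nat) (e : m.-tuple L).

Definition Xl (i : 'I_m) (f : G -> R^o) : G -> R^o :=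
  fun g => derive1 (fun t : R => f (g * E (t *: tnth e i))%g : R^o) 0.

Definition Xr (i : 'I_m) (f : G -> R^o) : G -> R^o :=
  fun g => derive1 (fun t : R => f (E (t *: tnth e i) * g)%g : R^o) 0.

Definition hlaplacian (f : G -> R^o) : G -> R^o :=
  fun g => \sum_(i < m) Xl i (Xl i f) g.

Definition rgrad_dot (u v : G -> R^o) : G -> R^o :=
  fun g => \sum_(j < m) Xr j u g * Xr j v g.

Definition rgrad_sqr (u : G -> R^o) : G -> R^o :=
  fun g => \sum_(j < m) Xr j u g ^+ 2.

End HorizontalOperators.
End LieAlgebra.

(* Main.v *)
Require Import Defs.
From HB Require Import structures.
From mathcomp Require Import all_boot all_order all_algebra.
From mathcomp Require Import all_classical all_reals all_analysis.
From mathcomp Require Import ring.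

Set Implicit Arguments.
Unset Strict Implicit.
Unset Printing Implicit Defensive.

Import Order.TTheory GRing.Theory Num.Theory.
Import numFieldNormedType.Exports.

Local Open Scope classical_set_scope.
Local Open Scope ring_scope.

(** A left-invariant field differentiates along right translations by its
    one-parameter group, a right-invariant field along left translations.
    Associativity makes the two translations independent of each other: with
      F (s, t) = f (E (s w) g E (t v)),
    where w = e_j and v = e_i, the one-parameter group law gives
      (Xr j f) (E (s w) g E (t v)) = d/ds F (s, t),
      (Xl i f) (E (s w) g E (t v)) = d/dt F (s, t)
    for every function on G, with no regularity assumption ([Xl_two_sided],
    [Xr_two_sided]).  All the calculus thus takes place in the plane.  If f is
    C^3 then so is F ([Ck_fun_along]), and the symmetry of second derivatives
    ([Ck_on_derive_comm]) says that Xl i and Xr j commute on C^2 functions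
    ([Xl_Xr_comm]).  Hence, for each i and j,
      Xl i (Xl i ((Xr j f)^2))
        = 2 (Xr j f) (Xl i (Xl i (Xr j f))) + 2 (Xl i (Xr j f))^2
        = 2 (Xr j f) (Xr j (Xl i (Xl i f))) + 2 (Xr j (Xl i f))^2,
    and the sum over i and j is the announced identity.  When the horizontal
    Laplacian of f is constant, each Xr j annihilates it and a sum of squares is
    left.

    The bulk of the work is the regularity of F: [Ck_on] is closed under
    sums, products and compositions, the last because a directional derivative
    of g \o f expands, in coordinates of the intermediate space, into products
    of coordinates of derivatives of f with derivatives of g along fixed
    vectors. *)

(** * Calculus of C^k maps between normed spaces *)

Section CkCalculus.
Context {R : realType}.
Implicit Types V W Z : normedModType R.

(** Differentiability is a local property: the two maps have the same remainder
    near the point. *)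
Lemma near_eq_differentiable V W (f g : V -> W) x :
  (\near x, f x = g x) -> differentiable f x -> differentiable g x.
Proof.
move=> fg df; have fgx := nbhs_singleton fg.
have dg : g \o shift x = cst (g x) + 'd f x +o_ 0 id.
  apply/eqaddoP => _/posnumP[eps].
  have /diff_locally/eqaddoP/(_ _ [gt0 of eps%:num]) := df.
  apply: filter_app; move: fg; rewrite (near_shift 0) subr0 => fg.
  near=> h => /=.
  rewrite -[X in `|X| <= _ -> _]/(f (h + x) - (f x + 'd f x h)).
  rewrite -[X in _ -> `|X| <= _]/(g (h + x) - (g x + 'd f x h)) fgx.
  suff -> : f (h + x) = g (h + x) by [].
  by near: h.
have dfc := diff_continuous df.
by apply/diff_locallyP; rewrite (diff_unique dfc dg).
Unshelve. all: by end_near. Qed.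

Lemma derive_comp V W Z (f : V -> W) (g : W -> Z) x v :
  differentiable f x -> differentiable g (f x) ->
  'D_v (g \o f) x = 'D_('D_v f x) g (f x).
Proof.
move=> df dg; rewrite deriveE; last exact: differentiable_comp.
by rewrite diff_comp// (deriveE _ df) (deriveE _ dg).
Qed.

(** Derivatives at a point of [U] see only values near that point, so openness
    of [U] lets a formula valid on [U] replace a derivative at every order. *)
Lemma eq_Ck_on V W k (U : set V) (f g : V -> W) :
  open U -> (forall x, U x -> f x = g x) -> Ck_on k U f -> Ck_on k U g.
Proof.
move=> oU; elim: k f g => [|k IH] f g fg /=.
  move=> cf x Ux; suff : g @ x --> g x by [].
  rewrite -(fg x Ux).
  apply: cvg_trans (cf x Ux); apply: near_eq_cvg.
  by apply: filterS (open_nbhs_nbhs (conj oU Ux)) => y /fg.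
move=> [df Df]; have nfg x : U x -> \near x, f x = g x.
  by move=> Ux; apply: filterS (open_nbhs_nbhs (conj oU Ux)) => y /fg.
split=> [x Ux|v]; first exact: near_eq_differentiable (nfg x Ux) (df x Ux).
by apply: IH (Df v) => x /nfg; exact: near_eq_derive.
Qed.

Lemma Ck_onW V W k (U : set V) (f : V -> W) : Ck_on k.+1 U f -> Ck_on k U f.
Proof.
elim: k f => [|k IH] f.
  by move=> [df _] x Ux; exact/differentiable_continuous/df.
by move=> [df Df]; split=> // v; apply: IH; exact: Df.
Qed.

Lemma sub_Ck_on V W k (U U' : set V) (f : V -> W) :
  U' `<=` U -> Ck_on k U f -> Ck_on k U' f.
Proof.
move=> UU'; elim: k f => [|k IH] f /=; first by move=> cf x /UU'; exact: cf.
by move=> [df Df]; split=> [x /UU'|v]; [exact: df|exact/IH/Df].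
Qed.

Lemma Ck_on_local V W k (U : set V) (f : V -> W) :
  (forall x, U x -> exists2 N, N x & Ck_on k N f) -> Ck_on k U f.
Proof.
elim: k f => [|k IH] f /= lf.
  by move=> x /lf[N Nx cf]; exact: cf.
split=> [x /lf[N Nx [df _]]|v]; first exact: df.
by apply: IH => x /lf[N Nx [_ Df]]; exists N.
Qed.

Lemma Ck_on_cst V W k (U : set V) (a : W) : Ck_on k U (fun=> a : W).
Proof.
elim: k a => [|k IH] a /=; first by move=> x _; exact: cst_continuous.
split=> [x _|v]; first exact: differentiable_cst.
rewrite [X in Ck_on _ _ X](_ : _ = fun=> 0 : W); first exact: IH.
by apply/funext => x; exact: derive_cst.
Qed.

Lemma Ck_on_linear V W k (U : set V) (l : {linear V -> W}) :
  continuous l -> Ck_on k U l.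
Proof.
move=> cl; case: k => [|k]; first by move=> x _; exact: cl.
split=> [x _|v]; first exact: linear_differentiable.
rewrite [X in Ck_on _ _ X](_ : _ = fun=> l v); first exact: Ck_on_cst.
by apply/funext => x; rewrite deriveE ?diff_lin//; exact: linear_differentiable.
Qed.

Lemma Ck_on_linear_comp V W Z k (U : set V) (f : V -> W) (l : {linear W -> Z}) :
  open U -> continuous l -> Ck_on k U f -> Ck_on k U (l \o f).
Proof.
move=> oU cl; elim: k f => [|k IH] f /=.
  by move=> cf x Ux; apply: continuous_comp; [exact: cf|exact: cl].
have dl y : differentiable l y by exact: linear_differentiable.
move=> [df Df]; split=> [x Ux|v].
  by apply: differentiable_comp; [exact: df|exact: dl].
apply: eq_Ck_on (IH _ (Df v)) => // x Ux.
by rewrite derive_comp//=; [rewrite (deriveE _ (dl _)) diff_lin|exact: df].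
Qed.

Lemma Ck_onD V W k (U : set V) (f g : V -> W) : open U ->
  Ck_on k U f -> Ck_on k U g -> Ck_on k U (fun x => f x + g x).
Proof.
move=> oU; elim: k f g => [|k IH] f g /=.
  by move=> cf cg x Ux; apply: continuousD; [exact: cf|exact: cg].
move=> [df Df] [dg Dg]; split=> [x Ux|v].
  by apply: differentiableD; [exact: df|exact: dg].
apply: eq_Ck_on (IH _ _ (Df v) (Dg v)) => // x Ux.
by rewrite -deriveD//; apply: diff_derivable; [exact: df|exact: dg].
Qed.

Lemma Ck_on_sum V W k (U : set V) (I : Type) (s : seq I) (f : I -> V -> W) :
  open U -> (forall i, Ck_on k U (f i)) ->
  Ck_on k U (fun x => \sum_(i <- s) f i x).
Proof.
move=> oU Cf; elim: s => [|i s IH].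
  apply: eq_Ck_on (@Ck_on_cst V W k U 0) => // x _; by rewrite big_nil.
apply: eq_Ck_on (Ck_onD oU (Cf i) IH) => // x _; by rewrite big_cons.
Qed.

(** Leibniz rule for the bilinear map [*:%R], composed with a pair. *)
Lemma diff_scale V W (a : V -> R^o) (h : V -> W) x :
  differentiable a x -> differentiable h x ->
  is_diff x (fun y => a y *: h y) (fun y => a x *: 'd h x y + 'd a x y *: h x).
Proof.
move=> da dh.
have bl : bilinear_for
    (GRing.Scale.Law.clone _ _ *:%R _) (GRing.Scale.Law.clone _ _ *:%R _)
    (@GRing.scale R W : R^o -> W -> W).
  by split=> [u'|u] c y z /=; [rewrite scalerDl scalerA|
    rewrite scalerDr !scalerA mulrC].
pose B : {bilinear R^o -> W -> W} := HB.pack (@GRing.scale R W : R^o -> W -> W)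
  (bilinear_isBilinear.Build R R^o W W _ _ (@GRing.scale R W) bl).
have Bc : continuous (fun p : R^o * W => B p.1 p.2) by exact: scale_continuous.
have dB := differentiable_bilin _ Bc.
have dp := differentiable_pair da dh.
split; first exact: (differentiable_comp dp (dB _)).
rewrite -[LHS]/('d ((fun p => B p.1 p.2) \o (fun y => (a y, h y))) x : V -> W).
by rewrite diff_comp// diff_bilin// diff_pair.
Qed.

Lemma derive_scale V W (a : V -> R^o) (h : V -> W) x v :
  differentiable a x -> differentiable h x ->
  'D_v (fun y => a y *: h y) x = a x *: 'D_v h x + 'D_v a x *: h x.
Proof.
move=> da dh; have dah := diff_scale da dh.
by rewrite !deriveE// diff_val.
Qed.

Lemma Ck_onZ V W k (U : set V) (a : V -> R^o) (h : V -> W) : open U ->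
  Ck_on k U a -> Ck_on k U h -> Ck_on k U (fun x => a x *: h x).
Proof.
move=> oU; elim: k a h => [|k IH] a h.
  by move=> ca ch x Ux; apply: continuousZ; [exact: ca|exact: ch].
move=> Ca Ch; have [da Da] := Ca; have [dh Dh] := Ch; split=> [x Ux|v].
  by have := diff_scale (da x Ux) (dh x Ux).
have := Ck_onD oU (IH _ _ (Ck_onW Ca) (Dh v)) (IH _ _ (Da v) (Ck_onW Ch)).
by apply: eq_Ck_on => // x Ux; rewrite derive_scale//; [exact: da|exact: dh].
Qed.

Lemma Ck_on_pair V W Z k (U : set V) (f : V -> W) (g : V -> Z) : open U ->
  Ck_on k U f -> Ck_on k U g -> Ck_on k U (fun x => (f x, g x)).
Proof.
move=> oU; elim: k f g => [|k IH] f g /=.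
  by move=> cf cg x Ux; apply: cvg_pair; [exact: cf|exact: cg].
move=> [df Df] [dg Dg]; split=> [x Ux|v].
  by apply: differentiable_pair; [exact: df|exact: dg].
apply: eq_Ck_on (IH _ _ (Df v) (Dg v)) => // x Ux.
have [dfx dgx] := (df x Ux, dg x Ux).
rewrite (deriveE _ (differentiable_pair dfx dgx)) diff_pair//.
by rewrite (deriveE _ dfx) (deriveE _ dgx).
Qed.

(** Finite dimension, through a finite family of vectors and continuous linear
    forms that decompose every vector; unlike a basis, such families pass to
    products without any independence check. *)
Definition finite_coordinates W : Prop :=
  exists s : seq (W * {l : {linear W -> R^o} | continuous l}),
    forall w, w = \sum_(p <- s) sval p.2 w *: p.1.

(** Chain rule at order k: the derivative of [g] along the moving vector
    ['D_v f x] is not of the form ['D_w g (f x)] with [w] fixed, so that vector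
    is expanded in coordinates, to which the induction hypothesis applies. *)
Lemma Ck_on_comp V W Z k (U : set V) (O : set W) (f : V -> W) (g : W -> Z) :
  finite_coordinates W -> open U -> (forall x, U x -> O (f x)) ->
  Ck_on k U f -> Ck_on k O g -> Ck_on k U (g \o f).
Proof.
move=> [s sE] oU fUO; elim: k g => [|k IH] g Cf Cg.
  move=> x Ux; apply: continuous_comp; first exact: Cf.
  exact/Cg/fUO.
have [df Df] := Cf; have [dg Dg] := Cg; split=> [x Ux|v].
  by apply: differentiable_comp; [exact: df|exact/dg/fUO].
have : Ck_on k U
    (fun x => \sum_(p <- s) sval p.2 ('D_v f x) *: 'D_(p.1) g (f x)).
  apply: Ck_on_sum => // p; apply: Ck_onZ => //.
    exact: Ck_on_linear_comp oU (svalP p.2) (Df v).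
  exact: IH (Ck_onW Cf) (Dg p.1).
apply: eq_Ck_on => // x Ux.
have dgfx := dg _ (fUO _ Ux); rewrite (derive_comp _ (df x Ux) dgfx).
rewrite [RHS](deriveE _ dgfx) {2}(sE ('D_v f x)) linear_sum.
by apply: eq_bigr => p _; rewrite linearZ/= (deriveE _ dgfx).
Qed.

Lemma finite_coordinates_line : finite_coordinates R^o.
Proof.
have cid : continuous (idfun : {linear R^o -> R^o}) by move=> x.
exists [:: (1 : R^o, exist _ (idfun : {linear R^o -> R^o}) cid)] => w.
by rewrite big_seq1/= [RHS]mulr1.
Qed.

Lemma finite_coordinates_rV n : finite_coordinates 'rV[R]_n.
Proof.
have lc (i : 'I_n) : linear (fun w : 'rV[R]_n => w 0 i : R^o).
  by move=> a u v; rewrite !mxE.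
pose L i : {linear 'rV[R]_n -> R^o} := HB.pack (fun w : 'rV[R]_n => w 0 i : R^o)
  (GRing.isLinear.Build _ _ _ _ _ (lc i)).
have cL i : continuous (L i) by exact: coord_continuous.
exists [seq (delta_mx 0 i : 'rV[R]_n, exist _ (L i) (cL i)) | i : 'I_n] => w.
by rewrite big_image/= [LHS]row_sum_delta.
Qed.

Lemma finite_coordinates_prod V W :
  finite_coordinates V -> finite_coordinates W ->
  finite_coordinates (V * W)%type.
Proof.
move=> [s sE] [t tE].
have cfst (l : {l : {linear V -> R^o} | continuous l}) :
    continuous (sval l \o fst : {linear (V * W)%type -> R^o}).
  move=> p; apply: continuous_comp; first exact: cvg_fst.
  exact: (svalP l).
have csnd (l : {l : {linear W -> R^o} | continuous l}) :
    continuous (sval l \o snd : {linear (V * W)%type -> R^o}).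
  move=> p; apply: continuous_comp; first exact: cvg_snd.
  exact: (svalP l).
exists ([seq ((p.1, 0) : V * W, exist _ _ (cfst p.2)) | p <- s] ++
        [seq ((0, p.1) : V * W, exist _ _ (csnd p.2)) | p <- t]) => -[v w].
have inlD : {morph (fun x : V => (x, 0) : V * W) : x y / x + y}.
  by move=> x y; apply/pair_equal_spec; split; rewrite //= addr0.
have inrD : {morph (fun y : W => (0, y) : V * W) : x y / x + y}.
  by move=> x y; apply/pair_equal_spec; split; rewrite //= addr0.
have -> : (v, w) = ((v, 0) : V * W) + (0, w).
  by apply/pair_equal_spec; rewrite /= addr0 add0r.
rewrite big_cat !big_map/= addr0 add0r {1}(sE v) {1}(tE w).
rewrite (big_morph _ inlD erefl) (big_morph _ inrD erefl).
by congr (_ + _); apply: eq_bigr => p _; apply/pair_equal_spec;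
  split; rewrite //= scaler0.
Qed.

(** * Symmetry of second derivatives *)

Lemma is_derive_ray V W (g : V -> W) y u (t : R) : derivable g (y + t *: u) u ->
  is_derive t 1 (fun s : R => g (y + s *: u)) ('D_u g (y + t *: u)).
Proof.
move=> dg.
have E : (fun h : R => h^-1 *:
    (((fun s : R => g (y + s *: u)) \o shift t) (h *: 1) - g (y + t *: u)))
  = (fun h => h^-1 *: ((g \o shift (y + t *: u)) (h *: u) - g (y + t *: u))).
  apply/funext => h /=; congr (_ *: (g _ - _)).
  by rewrite scalerDl [h *: 1]mulr1 addrCA.
by split; [rewrite /derivable E|rewrite /derive E].
Qed.

(** The mean value theorem is applied twice: along [v] to the difference of
    [f] between two parallel segments, then along [w] to ['D_v f].  The
    left-hand side is symmetric in [v] and [w]. *)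
Lemma second_difference V (f : V -> R^o) v w x (h : R) : 0 < h ->
  (forall y, differentiable f y) -> (forall y, differentiable ('D_v f) y) ->
  exists a b : R, [/\ 0 < a < h, 0 < b < h &
    f (x + h *: w + h *: v) - f (x + h *: v) - (f (x + h *: w) - f x) =
    h ^+ 2 * 'D_w ('D_v f) (x + a *: v + b *: w)].
Proof.
move=> h0 df dDf.
have ray (g : V -> R^o) y u (t : R) : (forall z, differentiable g z) ->
    is_derive t 1 (fun s : R => g (y + s *: u) : R) ('D_u g (y + t *: u)).
  by move=> dg; apply: is_derive_ray; exact: diff_derivable.
have cont (g dg : R -> R) : (forall t : R, is_derive t 1 g (dg t)) ->
    {within `[0, h], continuous g}.
  move=> g_dg; apply: continuous_subspaceT => t.
  by apply/differentiable_continuous/derivable1_diffP.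
pose phi (s : R) : R := f (x + h *: w + s *: v) - f (x + s *: v).
have dphi (t : R) : is_derive t 1 phi
    ('D_v f (x + h *: w + t *: v) - 'D_v f (x + t *: v)).
  by apply: is_deriveB; exact: ray.
have [a ah Ea] := MVT h0 (fun t _ => dphi t) (cont _ _ dphi).
pose psi (s : R) : R := 'D_v f (x + a *: v + s *: w).
have dpsi (t : R) : is_derive t 1 psi ('D_w ('D_v f) (x + a *: v + t *: w)).
  exact: ray.
have [b bh Eb] := MVT h0 (fun t _ => dpsi t) (cont _ _ dpsi).
exists a, b; split; [by move: ah; rewrite in_itv|by move: bh; rewrite in_itv|].
move: Ea Eb; rewrite /phi /psi !scale0r !addr0 subr0 => ->.
by rewrite [x + h *: w + _]addrAC => ->; rewrite -mulrA -expr2 mulrC.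
Qed.

(** Both mixed derivatives, at points close to [x], equal the same second
    difference divided by [h ^+ 2]; continuity brings them back to [x]. *)
Lemma Ck_on_derive_comm V (f : V -> R^o) v w :
  Ck_on 2 setT f -> 'D_v ('D_w f) = 'D_w ('D_v f).
Proof.
move=> [df Df]; apply/funext => x.
have cDD u u' : {for x, continuous ('D_u ('D_u' f))}.
  by have [_ /(_ u)/(_ x)] := Df u'; apply.
have dD u y : differentiable ('D_u f) y by have [dDf _] := Df u; exact: dDf.
have df' y : differentiable f y by exact: df.
apply/eqP; rewrite -subr_eq0 -normr_le0; apply/ler_addgt0Pr => e e0.
rewrite add0r; have e2 : 0 < e / 2 by rewrite divr_gt0.
have /cvgrPdist_lt/(_ _ e2) Nv := cDD v w.
have /cvgrPdist_lt/(_ _ e2) Nw := cDD w v.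
have [d /= d0 dball] := (nbhs_ballP _ _).1 (filterI Nv Nw).
(* with this [h], the parallelogram of sides [h *: v], [h *: w] at [x] lies in
   the ball; the [1] keeps [c] positive when both vectors vanish *)
pose c := `|v| + `|w| + 1; have c0 : 0 < c by rewrite ltr_wpDl// addr_ge0.
pose h := d / c; have h0 : 0 < h by rewrite divr_gt0.
have small u u' a b : `|u| + `|u'| < c -> 0 < a < h -> 0 < b < h ->
    ball x d (x + a *: u + b *: u').
  move=> uc /andP[a0 ah] /andP[b0 bh].
  rewrite -ball_normE /= -addrA opprD addNKr normrN.
  apply: le_lt_trans (ler_normD _ _) _; rewrite !normrZ !gtr0_norm//.
  apply: (@le_lt_trans _ _ (h * (`|u| + `|u'|))).
    by rewrite mulrDr lerD// ler_wpM2r// ltW.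
  by rewrite -ltr_pdivlMl// /h invfM invrK mulrAC mulVf ?mul1r// gt_eqF.
have [a [b [ah bh E1]]] := second_difference w x h0 df' (dD v).
have [a' [b' [ah' bh' E2]]] := second_difference v x h0 df' (dD w).
have vw : `|v| + `|w| < c by rewrite ltrDl.
have wv : `|w| + `|v| < c by rewrite addrC.
have [_ near1] := dball _ (small _ _ _ _ vw ah bh).
have [near2 _] := dball _ (small _ _ _ _ wv ah' bh').
have E : 'D_w ('D_v f) (x + a *: v + b *: w) =
         'D_v ('D_w f) (x + a' *: w + b' *: v).
  apply: (@mulfI _ (h ^+ 2)); first by rewrite expf_neq0// gt_eqF.
  have swap (p q r s : R) : p - q - (r - s) = p - r - (q - s) by ring.
  by rewrite -[LHS]E1 -[RHS]E2 [x + h *: w + h *: v]addrAC; exact: swap.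
rewrite /= E in near1; rewrite /= in near2; rewrite [e]splitr.
apply: le_trans (ler_distD ('D_v ('D_w f) (x + a' *: w + b' *: v)) _ _) _.
by apply: lerD; [exact: ltW near2|rewrite distrC; exact: ltW near1].
Qed.

End CkCalculus.

(** * C^k maps from a normed space to a manifold *)

Section CkMaps.
Context {R : realType}.
Implicit Types V W Z : normedModType R.
Implicit Types M N : topologicalType.

(** What the composition of maps through charts asks of the intermediate atlas,
    in a form that passes to product atlases at once. *)
Definition covering_atlas M (T : Type) (A : set (chart M T)) : Prop :=
  [/\ forall a, A a -> open (cdom a),
      forall a x, A a -> cdom a x -> cinv a (cmap a x) = x &
      forall x, exists2 a, A a & cdom a x].

Lemma covering_id_chart V : covering_atlas [set id_chart V].
Proof.
split=> [a ->|a x ->|x] //=; first exact: openT.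
by exists (id_chart V).
Qed.

Lemma smooth_atlas_covering M V (A : set (chart M V)) :
  is_smooth_atlas A -> covering_atlas A.
Proof.
move=> [Ac Acov _]; split=> // [a /Ac[]|a x /Ac[_ _ _ _]] //.
by apply.
Qed.

Lemma covering_prod_atlas M N V W (A : set (chart M V)) (B : set (chart N W)) :
  covering_atlas A -> covering_atlas B -> covering_atlas (prod_atlas A B).
Proof.
move=> [Ao AK Ac] [Bo BK Bc]; split.
- move=> _ [a [b [Aa Bb ->]]] /=; rewrite openE => -[x y] [/= ax yb].
  exists (cdom a, cdom b) => //=.
  by split; apply: open_nbhs_nbhs; split=> //; [exact: Ao|exact: Bo].
- by move=> _ [x y] [a [b [Aa Bb ->]]] [/= ax yb] /=; rewrite AK// BK.
- move=> [x y]; have [a Aa ax] := Ac x; have [b Bb yb] := Bc y.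
  by exists (prod_chart a b) => //; exists a, b.
Qed.

Lemma Ck_map_idE V M W k (A : set (chart M W)) (p : V -> M) :
  Ck_map k [set id_chart V] A p <->
  continuous p /\
  forall a, A a -> Ck_on k (p @^-1` cdom a) (cmap a \o p).
Proof.
split=> -[cp Cp]; split=> //.
  by move=> a /(Cp _ _ erefl); rewrite /= setTI image_id.
by move=> _ a -> /Cp; rewrite /= setTI image_id.
Qed.

(** Near each point the composite factors through a chart [a] of the
    intermediate manifold, as [(cmap b \o F \o cinv a) \o (cmap a \o p)]. *)
Lemma Ck_map_comp V M N W Z k (A : set (chart M W)) (B : set (chart N Z))
    (p : V -> M) (F : M -> N) :
  covering_atlas A -> covering_atlas B -> finite_coordinates W ->
  Ck_map k [set id_chart V] A p -> Ck_map k A B F ->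
  Ck_map k [set id_chart V] B (F \o p).
Proof.
move=> [Ao AK Ac] [Bo _ _] fW /Ck_map_idE[cp Cp] [cF CF]; apply/Ck_map_idE.
have cFp : continuous (F \o p).
  by move=> x; apply: continuous_comp; [exact: cp|exact: cF].
split=> // b Bb; apply: Ck_on_local => x bx.
have [a Aa ax] := Ac (p x).
pose U := p @^-1` cdom a `&` (F \o p) @^-1` cdom b.
exists U; first by split.
have oU : open U.
  by apply: openI; apply: open_comp => [y _|];
    [exact: cp|exact: Ao|exact: cFp|exact: Bo].
have CU : Ck_on k U (cmap a \o p).
  by apply: sub_Ck_on (Cp a Aa); exact: subIsetl.
apply: eq_Ck_on (Ck_on_comp fW oU _ CU (CF a b Aa Bb)) => // y [/= ay yb].
  by rewrite AK.
by exists (p y).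
Qed.

Lemma Ck_map_pair V M N W Z k (A : set (chart M W)) (B : set (chart N Z))
    (p : V -> M) (q : V -> N) :
  covering_atlas A -> covering_atlas B ->
  Ck_map k [set id_chart V] A p -> Ck_map k [set id_chart V] B q ->
  Ck_map k [set id_chart V] (prod_atlas A B) (fun x => (p x, q x)).
Proof.
move=> [Ao _ _] [Bo _ _] /Ck_map_idE[cp Cp] /Ck_map_idE[cq Cq].
apply/Ck_map_idE; split.
  by move=> x; apply: cvg_pair; [exact: cp|exact: cq].
move=> _ [a [b [Aa Bb ->]]].
have oU : open (p @^-1` cdom a `&` q @^-1` cdom b).
  by apply: openI; apply: open_comp => [y _|];
    [exact: cp|exact: Ao|exact: cq|exact: Bo].
apply: (@Ck_on_pair _ _ _ _ k _ (cmap a \o p) (cmap b \o q)) => //.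
  by apply: sub_Ck_on (Cp a Aa); exact: subIsetl.
by apply: sub_Ck_on (Cq b Bb); exact: subIsetr.
Qed.

Lemma Ck_map_cst V M W k (A : set (chart M W)) (x : M) :
  Ck_map k [set id_chart V] A (fun=> x).
Proof.
apply/Ck_map_idE; split; first exact: cst_continuous.
by move=> a _; exact: Ck_on_cst.
Qed.

Lemma Ck_map_linear V W k (l : {linear V -> W}) : continuous l ->
  Ck_map k [set id_chart V] [set id_chart W] l.
Proof.
by move=> cl; apply/Ck_map_idE; split=> // _ ->; exact: Ck_on_linear.
Qed.

End CkMaps.

(** * Invariant fields as partial derivatives of two-sided translates *)

Section TwoSidedTranslates.
Context {R : realType} {n : nat} {G : lieGroupType R n}.
Let lieA := @lie_atlas R n G.

Let cov : covering_atlas lieA.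
Proof. exact: smooth_atlas_covering (@lie_atlas_smooth R n G). Qed.

Lemma Ck_map_mulg (V : normedModType R) k (p q : V -> G) :
  Ck_map k [set id_chart V] lieA p -> Ck_map k [set id_chart V] lieA q ->
  Ck_map k [set id_chart V] lieA (fun x => (p x * q x)%g).
Proof.
move=> Cp Cq.
have fc := @finite_coordinates_rV R n.
exact: (Ck_map_comp (covering_prod_atlas cov cov) cov
  (finite_coordinates_prod fc fc) (Ck_map_pair cov cov Cp Cq)
  (@lie_mul_smooth R n G k)).
Qed.

Lemma Ck_on_pullback (V : normedModType R) k (p : V -> G) (u : G -> R^o) :
  Ck_map k [set id_chart V] lieA p -> Ck_fun k u -> Ck_on k setT (u \o p).
Proof.
move=> Cp Cu.
have /Ck_map_idE[_] := Ck_map_comp cov (@covering_id_chart R R^o)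
  (@finite_coordinates_rV R n) Cp Cu.
by move=> /(_ _ erefl).
Qed.

Context {L : lieAlgebra G} (E : L -> G) (hE : is_exponential E).

Lemma exponentialD (v : L) s t : E ((s + t) *: v) = (E (s *: v) * E (t *: v))%g.
Proof. by have [_] := hE v. Qed.

Lemma exponential0 (v : L) : E (0 *: v) = 1%g.
Proof.
apply: (@mulgI _ (E (0 *: v))).
by rewrite -exponentialD addr0 mulg1.
Qed.

(** The plane through [g] on which the right-invariant field of [w] and the
    left-invariant field of [v] become the two coordinate fields. *)
Definition two_sided (w v : L) (g : G) (p : R^o * R^o) : G :=
  (E (p.1 *: w) * g * E (p.2 *: v))%g.

Lemma two_sided0 w v g : two_sided w v g 0 = g.
Proof. by rewrite /two_sided !exponential0 mul1g mulg1. Qed.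

Lemma Ck_map_two_sided k w v g :
  Ck_map k [set id_chart (R^o * R^o)%type] lieA (two_sided w v g).
Proof.
have cR := @covering_id_chart R R^o; have fR := @finite_coordinates_line R.
have curve (u : L) :
    Ck_map k [set id_chart R^o] lieA (fun t : R^o => E (t *: u)).
  by have [/(_ k)] := hE u.
have cfst : continuous (fst : R^o * R^o -> R^o) by move=> x; exact: cvg_fst.
have csnd : continuous (snd : R^o * R^o -> R^o) by move=> x; exact: cvg_snd.
have left_curve := Ck_map_comp cR cov fR
  (@Ck_map_linear R (R^o * R^o)%type R^o k fst cfst) (curve w).
have right_curve := Ck_map_comp cR cov fR
  (@Ck_map_linear R (R^o * R^o)%type R^o k snd csnd) (curve v).
exact: Ck_map_mulg (Ck_map_mulg left_curve (Ck_map_cst _ k lieA g)) right_curve.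
Qed.

(** The group law [E ((t + h) *: v) = E (t *: v) * E (h *: v)] identifies the
    difference quotients: both sides are the limit of one and the same
    function, convergent or not. *)
Lemma Xl_two_sided (m : nat) (e : m.-tuple L) i w g (u : G -> R^o) p :
  Xl E e i u (two_sided w (tnth e i) g p) =
  'D_((0, 1) : R^o * R^o) (u \o two_sided w (tnth e i) g) p.
Proof.
rewrite /Xl /derive1 /derive.
set d := (fun _ : R => _); set d' := (fun _ : R => _).
suff -> : d = d' by []; apply/funext => h; rewrite /d /d' /=.
rewrite addr0 exponential0 mulg1; congr (_ *: (u _ - _)).
rewrite /two_sided /= [h *: 0]mulr0 [h *: 1]mulr1 add0r -!mulgA.
by rewrite -exponentialD addrC.
Qed.

Lemma Xr_two_sided (m : nat) (e : m.-tuple L) j v g (u : G -> R^o) p :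
  Xr E e j u (two_sided (tnth e j) v g p) =
  'D_((1, 0) : R^o * R^o) (u \o two_sided (tnth e j) v g) p.
Proof.
rewrite /Xr /derive1 /derive.
set d := (fun _ : R => _); set d' := (fun _ : R => _).
suff -> : d = d' by []; apply/funext => h; rewrite /d /d' /=.
rewrite addr0 exponential0 mul1g; congr (_ *: (u _ - _)).
rewrite /two_sided /= [h *: 0]mulr0 [h *: 1]mulr1 add0r !mulgA.
by rewrite -exponentialD.
Qed.

(** In the planes [two_sided w v g] the fields of [v] and [w] are partial
    derivatives, so they visibly lower the order of this regularity by one,
    without a return to the charts of [G]. *)
Definition Ck_along (w v : L) k (u : G -> R^o) : Prop :=
  forall g, Ck_on k setT (u \o two_sided w v g).

Lemma Ck_fun_along w v k u : Ck_fun k u -> Ck_along w v k u.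
Proof. by move=> Cu g; apply: Ck_on_pullback Cu; exact: Ck_map_two_sided. Qed.

Lemma Ck_alongM w v k u u' : Ck_along w v k u -> Ck_along w v k u' ->
  Ck_along w v k (fun g => u g * u' g).
Proof.
by move=> Cu Cu' g; exact: (@Ck_onZ _ _ R^o _ _ _ _ openT (Cu g) (Cu' g)).
Qed.

Lemma Ck_along_derivable w v u g d :
  Ck_along w v 1 u -> derivable (u \o two_sided w v g) 0 d.
Proof. by move=> Cu; apply: diff_derivable; have [du _] := Cu g; exact: du. Qed.

Context {m : nat} (e : m.-tuple L).

Lemma XlE w i g u :
  Xl E e i u g = 'D_((0, 1) : R^o * R^o) (u \o two_sided w (tnth e i) g) 0.
Proof. by rewrite -Xl_two_sided two_sided0. Qed.

Lemma XrE v j g u :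
  Xr E e j u g = 'D_((1, 0) : R^o * R^o) (u \o two_sided (tnth e j) v g) 0.
Proof. by rewrite -Xr_two_sided two_sided0. Qed.

Lemma Xl_along w i g u : Xl E e i u \o two_sided w (tnth e i) g =
  'D_((0, 1) : R^o * R^o) (u \o two_sided w (tnth e i) g).
Proof. by apply/funext => p; exact: Xl_two_sided. Qed.

Lemma Xr_along v j g u : Xr E e j u \o two_sided (tnth e j) v g =
  'D_((1, 0) : R^o * R^o) (u \o two_sided (tnth e j) v g).
Proof. by apply/funext => p; exact: Xr_two_sided. Qed.

Lemma Ck_along_Xl w i k u :
  Ck_along w (tnth e i) k.+1 u -> Ck_along w (tnth e i) k (Xl E e i u).
Proof. by move=> Cu g; rewrite Xl_along; have [_ Du] := Cu g; exact: Du. Qed.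

Lemma Ck_along_Xr v j k u :
  Ck_along (tnth e j) v k.+1 u -> Ck_along (tnth e j) v k (Xr E e j u).
Proof. by move=> Cu g; rewrite Xr_along; have [_ Du] := Cu g; exact: Du. Qed.

(** Symmetry of the second derivatives of [u \o two_sided _ _ g] at 0. *)
Lemma Xl_Xr_comm i j u : Ck_along (tnth e j) (tnth e i) 2 u ->
  Xl E e i (Xr E e j u) = Xr E e j (Xl E e i u).
Proof.
move=> Cu; apply/funext => g.
rewrite (XlE (tnth e j)) (XrE (tnth e i)) Xr_along Xl_along.
exact: (congr1 (@^~ 0) (Ck_on_derive_comm _ _ (Cu g))).
Qed.

Lemma is_derive_Xl w i u g : Ck_along w (tnth e i) 1 u ->
  is_derive (0 : R) 1 (fun t : R => u (g * E (t *: tnth e i))%g)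
    (Xl E e i u g).
Proof.
move=> Cu.
have du : derivable (u \o two_sided w (tnth e i) g)
    (0 + (0 : R) *: ((0, 1) : R^o * R^o)) ((0, 1) : R^o * R^o).
  by rewrite scale0r addr0; exact: Ck_along_derivable.
have := is_derive_ray du; rewrite scale0r addr0 -XlE.
rewrite [X in is_derive _ _ X](_ : _ =
  (fun t : R => u (g * E (t *: tnth e i))%g)) //.
apply/funext => t /=; rewrite /two_sided /= !add0r [t *: 0]mulr0 [t *: 1]mulr1.
by rewrite exponential0 mul1g.
Qed.

Lemma is_derive_Xr v j u g : Ck_along (tnth e j) v 1 u ->
  is_derive (0 : R) 1 (fun t : R => u (E (t *: tnth e j) * g)%g)
    (Xr E e j u g).
Proof.
move=> Cu.
have du : derivable (u \o two_sided (tnth e j) v g)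
    (0 + (0 : R) *: ((1, 0) : R^o * R^o)) ((1, 0) : R^o * R^o).
  by rewrite scale0r addr0; exact: Ck_along_derivable.
have := is_derive_ray du; rewrite scale0r addr0 -XrE.
rewrite [X in is_derive _ _ X](_ : _ =
  (fun t : R => u (E (t *: tnth e j) * g)%g)) //.
apply/funext => t /=; rewrite /two_sided /= !add0r [t *: 0]mulr0 [t *: 1]mulr1.
by rewrite exponential0 mulg1.
Qed.

(** The plane [w j] may vary with the summand: only the curve
    [t |-> g * E (t *: tnth e i)], common to all these planes, is involved. *)
Lemma Xl_sum i (k : nat) (w : 'I_k -> L) (u : 'I_k -> G -> R^o) :
  (forall j, Ck_along (w j) (tnth e i) 1 (u j)) ->
  Xl E e i (fun g => \sum_(j < k) u j g) =
  (fun g => \sum_(j < k) Xl E e i (u j) g).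
Proof.
move=> Cu; apply/funext => g; rewrite {1}/Xl derive1E.
have -> : (fun t : R => \sum_(j < k) u j (g * E (t *: tnth e i))%g : R^o) =
    \sum_(j < k) (fun t : R => u j (g * E (t *: tnth e i))%g : R^o).
  by apply/funext => t; rewrite fct_sumE.
have du j := is_derive_Xl g (Cu j).
exact: derive_val.
Qed.

Lemma Xr_sum j (k : nat) (v : 'I_k -> L) (u : 'I_k -> G -> R^o) :
  (forall i, Ck_along (tnth e j) (v i) 1 (u i)) ->
  Xr E e j (fun g => \sum_(i < k) u i g) =
  (fun g => \sum_(i < k) Xr E e j (u i) g).
Proof.
move=> Cu; apply/funext => g; rewrite {1}/Xr derive1E.
have -> : (fun t : R => \sum_(i < k) u i (E (t *: tnth e j) * g)%g : R^o) =
    \sum_(i < k) (fun t : R => u i (E (t *: tnth e j) * g)%g : R^o).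
  by apply/funext => t; rewrite fct_sumE.
have du i := is_derive_Xr g (Cu i).
exact: derive_val.
Qed.

Lemma Xl_mul w i u u' :
  Ck_along w (tnth e i) 1 u -> Ck_along w (tnth e i) 1 u' ->
  Xl E e i (fun g => u g * u' g) =
  (fun g => u g * Xl E e i u' g + u' g * Xl E e i u g).
Proof.
move=> Cu Cu'; apply/funext => g; rewrite {1}/Xl derive1E.
have du := is_derive_Xl g Cu; have du' := is_derive_Xl g Cu'.
rewrite [LHS](@derive_val _ _ _ _ _ _ _ (is_deriveM du du')).
by rewrite exponential0 mulg1.
Qed.

Lemma Xl_Xl_sqr w i u : Ck_along w (tnth e i) 2 u ->
  Xl E e i (Xl E e i (fun g => u g ^+ 2)) =
  (fun g => 2 * (u g * Xl E e i (Xl E e i u) g) + 2 * Xl E e i u g ^+ 2).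
Proof.
move=> Cu; have Cu1 : Ck_along w (tnth e i) 1 u.
  by move=> g; exact: Ck_onW (Cu g).
have CXu := Ck_along_Xl Cu; have CuXu := Ck_alongM Cu1 CXu.
(* the double of a function is written as a sum over ['I_2], to which [Xl_sum]
   applies *)
rewrite [X in Xl _ _ _ X](_ : _ = fun g => \sum_(j < 2) (u g * Xl E e i u g)).
  rewrite (Xl_sum (w := fun=> w)) // (Xl_mul Cu1 CXu); apply/funext => g.
  by rewrite big_ord_recl big_ord1; ring.
rewrite (Xl_mul Cu1 Cu1); apply/funext => g.
by rewrite big_ord_recl big_ord1.
Qed.

End TwoSidedTranslates.

Theorem proposition3p4 (R : realType) (n : nat) (G : lieGroupType R n)
    (C : carnot G) (E : carnot_lie C -> G) (hE : is_exponential E)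
    (e : (hdim C).-tuple (carnot_lie C)) (he : orthonormal_hbasis e)
    (f : G -> R^o) (hf : Ck_fun 3 f) :
  (forall g : G,
     hlaplacian E e (rgrad_sqr E e f) g =
       2 * rgrad_dot E e f (hlaplacian E e f) g +
       2 * \sum_(i < hdim C) rgrad_sqr E e (Xl E e i f) g) /\
  (forall c : R, (forall g : G, hlaplacian E e f g = c) ->
     forall g : G,
       hlaplacian E e (rgrad_sqr E e f) g =
         2 * \sum_(i < hdim C) rgrad_sqr E e (Xl E e i f) g /\
       0 <= 2 * \sum_(i < hdim C) rgrad_sqr E e (Xl E e i f) g).
Proof.
have bochner g : hlaplacian E e (rgrad_sqr E e f) g =
    2 * rgrad_dot E e f (hlaplacian E e f) g +
    2 * \sum_(i < hdim C) rgrad_sqr E e (Xl E e i f) g.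
  have C3 i j : Ck_along E (tnth e j) (tnth e i) 3 f by exact: Ck_fun_along.
  have C2 i j : Ck_along E (tnth e j) (tnth e i) 2 f.
    by move=> h; exact: Ck_onW (C3 i j h).
  have CXr i j := Ck_along_Xr hE (C3 i j).
  have CXl i j := Ck_along_Xl hE (C3 i j).
  have CXlXl i j := Ck_along_Xl hE (CXl i j).
  have Csqr i j :
      Ck_along E (tnth e j) (tnth e i) 2 (fun h => Xr E e j f h ^+ 2).
    exact: Ck_alongM (CXr i j) (CXr i j).
  have Csqr1 i j :
      Ck_along E (tnth e j) (tnth e i) 1 (fun h => Xr E e j f h ^+ 2).
    by move=> h; exact: Ck_onW (Csqr i j h).
  have comm i j : Xl E e i (Xr E e j f) = Xr E e j (Xl E e i f).
    exact: Xl_Xr_comm (C2 i j).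
  have lap_dot : rgrad_dot E e f (hlaplacian E e f) g =
      \sum_(i < hdim C) \sum_(j < hdim C)
        Xr E e j f g * Xr E e j (Xl E e i (Xl E e i f)) g.
    rewrite exchange_big; apply: eq_bigr => j _; rewrite -mulr_sumr.
    by rewrite /hlaplacian (Xr_sum hE (fun i => CXlXl i j)).
  rewrite lap_dot !mulr_sumr -big_split; apply: eq_bigr => i _ /=.
  rewrite /rgrad_sqr (Xl_sum hE (Csqr1 i)).
  rewrite (Xl_sum hE (fun j => Ck_along_Xl hE (Csqr i j))).
  rewrite !mulr_sumr -big_split; apply: eq_bigr => j _ /=.
  by rewrite (Xl_Xl_sqr hE (CXr i j)) !comm (Xl_Xr_comm hE (CXl i j)).
split=> [//|c lapc] g; split; last first.
  apply: mulr_ge0 => //; apply: sumr_ge0 => i _; apply: sumr_ge0 => j _.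
  exact: sqr_ge0.
rewrite bochner /rgrad_dot big1 ?mulr0 ?add0r// => j _.
by rewrite (_ : hlaplacian E e f = fun=> c) ?/Xr ?derive1_cst ?mulr0//;
  exact/funext.
Qed.
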